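(* Let $h_{V_8}(x_1,\ldots,x_8)\in\mathbb{R}[x_1,\ldots,x_8]$ be the bases generating polynomial of the Vámos cube $V_8$, and let $p(x)=h_{V_8}(x_1+1,\ldots,x_8+1)$. Then: (1) $p$ is a real zero polynomial, i.e. for each $x\in\mathbb{R}^8$ and $\mu\in\mathbb{C}$, $p(\mu x)=0$ implies that $\mu$ is real; (2) there is no positive integer $N$ such that $p(x)^N$ has a determinantal representation.
   Context: The Vámos cube $V_8$ is the rank-$4$ matroid on the ground set $\{1,\ldots,8\}$ whose set of bases $\mathcal{B}(V_8)$ consists of all $4$-element subsets of $\{1,\ldots,8\}$ except the five sets $$\{1,2,3,4\},\ \{1,4,5,6\},\ \{2,3,5,6\},\ \{1,4,7,8\},\ \{2,3,7,8\}.$$ Its bases generating polynomial is $$h_{V_8}(x)=\sum_{S\in\mathcal{B}(V_8)}\ \prod_{j\in S}x_j .$$ A polynomial $q\in\mathbb{R}[x_1,\ldots,x_n]$ has a determinantal representation if there are a positive integer $m$ and $m\times m$ matrices $A_1,\ldots,A_n$, all real symmetric or, more generally, all complex Hermitian, such that $q(x_1,\ldots,x_n)=\det(I+x_1A_1+\cdots+x_nA_n)$ as polynomials, where $I$ is the $m\times m$ identity matrix. No restriction is placed on the size $m$. *)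

(* Defs.v *)
From HB Require Import structures.
From mathcomp Require Import all_boot all_order all_algebra.
From mathcomp Require Import reals complex mpoly.
Set Implicit Arguments.
Unset Strict Implicit.
Unset Printing Implicit Defensive.
Import Order.TTheory GRing.Theory Num.Theory.
Local Open Scope ring_scope.

(* The ground set {1, ..., 8} is modelled by 'I_8 = {0, ..., 7}; the label k
   stands for the ordinal of value k - 1. *)
Definition vlabel (k : nat) : 'I_8 := inord k.-1.

Definition vset4 (a b c d : nat) : {set 'I_8} :=
  [set vlabel a; vlabel b; vlabel c; vlabel d].

Definition vamos_circuit_hyperplanes : {set {set 'I_8}} :=
  [set vset4 1 2 3 4; vset4 1 4 5 6; vset4 2 3 5 6;
       vset4 1 4 7 8; vset4 2 3 7 8].

Definition vamos_bases : {set {set 'I_8}} :=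
  [set S : {set 'I_8} | (#|S| == 4) && (S \notin vamos_circuit_hyperplanes)].

Definition bases_genpoly (R : realType) (n : nat) (B : {set {set 'I_n}}) :
    {mpoly R[n]} :=
  \sum_(S in B) \prod_(j in S) 'X_j.

Definition h_vamos (R : realType) : {mpoly R[8]} := bases_genpoly R vamos_bases.

Definition shift1 (R : realType) (n : nat) (q : {mpoly R[n]}) : {mpoly R[n]} :=
  q \mPo [tuple 'X_i + 1 | i < n].

Definition p_vamos (R : realType) : {mpoly R[8]} := shift1 (h_vamos R).

Definition real_zero_poly (R : realType) (n : nat) (q : {mpoly R[n]}) : Prop :=
  forall (x : 'I_n -> R) (mu : R[i]),
    (map_mpoly (real_complex R) q).@[fun i => mu * (x i)%:C%C] = 0 ->
    complex.Im mu = 0.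

(* det (I + x_1 A_1 + ... + x_n A_n), as a polynomial. *)
Definition det_pencil (K : comNzRingType) (n m : nat) (A : 'I_n -> 'M[K]_m) :
    {mpoly K[n]} :=
  \det (1%:M + \sum_(i < n) 'X_i *: map_mx (@mpolyC n K) (A i)).

Definition has_det_rep (R : realType) (n : nat) (q : {mpoly R[n]}) : Prop :=
  exists2 m : nat, (0 < m)%N &
    (exists2 A : 'I_n -> 'M[R]_m,
       forall i, A i \is symmetricmx & q = det_pencil A) \/
    (exists2 A : 'I_n -> 'M[R[i]]_m,
       forall i, A i \is hermsymmx &
       map_mpoly (real_complex R) q = det_pencil A).

(* A polynomial with a determinantal representation takes the value 1 at the
   origin, whereas p_vamos takes the value 65 (the number of bases) there;
   rescaling by the value at 0 removes this elementary obstruction. *)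
Definition normalized (R : realType) (n : nat) (q : {mpoly R[n]}) :
    {mpoly R[n]} :=
  (q.@[fun=> 0])^-1 *: q.

(* Main.v *)
Require Import Defs.
From mathcomp Require Import all_boot all_order all_algebra.
From mathcomp Require Import reals complex mpoly.
From mathcomp Require Import polyrcf zify ring lra.

(** Group the labels into the pairs {1,4}, {2,3}, {5,6}, {7,8}.  The five
    circuit hyperplanes are the unions of two pairs, except {5,6,7,8}, so h is
    affine in the sum and the product of each pair.

    Real zeros.  If p (mu x) = 0 with mu not real, then h vanishes at the point
    1 + mu x, and by homogeneity at a multiple of it all of whose coordinates
    lie in the open upper half-plane.  Replacing the two variables of a pair by
    one variable of the half-plane (Grace-Walsh-Szego for two variables,
    [merge_pair]) leads to a zero in the half-plane of
      q = 4 (a+b+c+d) (bcd+acd+abd+abc) + (cd)^2.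
    Along a real line in a positive direction, compare q with its first and
    second derivatives in a, which up to constants are [cubic] and [quad].  The
    quadratic has two real roots, it interlaces the cubic, and at a root of the
    cubic the product of q and the quadratic is minus the Rayleigh difference
    ((b+c)(b+d)(c+d))^2 - (bc+bd+cd)(cd)^2.  That difference is positive off a
    set of codimension two ([rayleigh_gt0]), so on a generic line q changes sign
    between consecutive roots of the cubic and has four real roots
    ([quartic_line_real_rooted]).  For generic real x and positive y this gives
    |q(x + iy)| >= q(y) > 0; the bound is a closed condition on x, so q has no
    zero in the half-plane ([quartic_stable]).

    Determinantal representations.  A representation of p^N itself would give
    65^N = 1 at the origin.  Suppose (p/65)^N = det (I + sum x_i A_i) with
    Hermitian A_i.  Restricting to a coordinate axis, where p is affine, shows
    that each A_i is a positive multiple of an orthogonal projection.  For such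
    matrices the range of a partial sum is the sum of the ranges.  The rank of
    the sum over a set S of labels is the degree of p^N along the indicator
    vector of S, which is N times the rank of S in the matroid.  Hence N times
    the Vamos rank function is a dimension function of subspaces.  Applied to
    the four pairs, the Ingleton inequality reads 16 N <= 15 N. *)

Set Implicit Arguments.
Unset Strict Implicit.
Unset Printing Implicit Defensive.
Import Order.TTheory GRing.Theory Num.Theory.
Local Open Scope ring_scope.

(** * The bases generating polynomial in explicit form *)

(** The elementary symmetric polynomials of a list, by the recursion on the
    list; for a list of known length this computes an explicit expression. *)
Fixpoint elem_sym (K : comNzRingType) (s : seq K) (k : nat) : K :=
  match s, k with
  | [::], 0%N => 1
  | [::], _.+1 => 0
  | _ :: _, 0%N => 1
  | a :: s', k'.+1 => a * elem_sym s' k' + elem_sym s' k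
  end.

Lemma coef_prod_elem_sym (K : comNzRingType) (s : seq K) (k : nat) :
  (\prod_(a <- s) (a *: 'X + 1))`_k = elem_sym s k.
Proof.
elim: s k => [|a s IHs] k; first by rewrite big_nil coef1; case: k.
rewrite big_cons mulrDl mul1r -scalerAl coefD coefZ coefXM.
case: k => [|k] /=; first by rewrite mulr0 add0r IHs; case: (s).
by rewrite !IHs.
Qed.

(** Both sides are coefficients of the product of the [1 + v_i X], which can be
    expanded over subsets or one factor at a time. *)
Lemma sum_card_elem_sym (K : comNzRingType) (n : nat) (v : 'I_n -> K) k :
  \sum_(S : {set 'I_n} | #|S| == k) \prod_(j in S) v j
    = elem_sym [seq v i | i <- enum 'I_n] k.
Proof.
rewrite -coef_prod_elem_sym big_map big_enum /=.
rewrite (bigA_distr _ _ (fun i => v i *: 'X) (fun=> 1)) coef_sum.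
rewrite [LHS]big_mkcond; apply: eq_bigr => S _.
have -> : \prod_i (if i \in S then v i *: 'X else 1)
          = (\prod_(j in S) v j)%:P * 'X^#|S| :> {poly K}.
  rewrite -big_mkcond /= (eq_bigr (fun i => (v i)%:P * 'X)); last first.
    by move=> i _; rewrite mul_polyC.
  by rewrite big_split /= rmorph_prod prodr_const.
by rewrite coefCM coefXn eq_sym; case: eqP; rewrite ?mulr1 ?mulr0.
Qed.

Lemma enum_ord8 : enum 'I_8 = [seq vlabel k | k <- iota 1 8].
Proof.
apply: (inj_map val_inj); rewrite val_enum_ord -map_comp /=.
by rewrite /vlabel !inordK.
Qed.

Lemma vlabel_inj : {in iota 1 8 &, injective vlabel}.
Proof.
move=> x y; rewrite !mem_iota => /andP[x0 x8] /andP[y0 y8].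
move=> /(congr1 val); rewrite /= !inordK; last 2 first.
- by case: y y0 y8.
- by case: x x0 x8.
by case: x y x0 y0 {x8 y8} => // x [] // y _ _ /= ->.
Qed.

Lemma vset4E (a b c d : nat) :
  vset4 a b c d =i [seq vlabel k | k <- [:: a; b; c; d]].
Proof. by move=> i; rewrite !inE !orbA. Qed.

Lemma uniq_vlabel (s : seq nat) :
  {subset s <= iota 1 8} -> uniq s -> uniq [seq vlabel k | k <- s].
Proof.
move=> ss us; rewrite map_inj_in_uniq // => x y /ss xs /ss.
exact: vlabel_inj.
Qed.

Lemma mem_vset4 (a b c d k : nat) :
  {subset [:: k; a; b; c; d] <= iota 1 8} ->
  (vlabel k \in vset4 a b c d) = (k \in [:: a; b; c; d]).
Proof.
move=> ss; rewrite vset4E; apply/mapP/idP => [[y ys /vlabel_inj->] //|ks].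
- by apply: ss; rewrite mem_head.
- by apply: ss; rewrite inE ys orbT.
by exists k.
Qed.

Lemma card_vset4 (a b c d : nat) :
  {subset [:: a; b; c; d] <= iota 1 8} -> uniq [:: a; b; c; d] ->
  #|vset4 a b c d| = 4%N.
Proof.
move=> ss us; rewrite (eq_card (vset4E a b c d)).
by rewrite (card_uniqP (uniq_vlabel ss us)).
Qed.

Section VamosForm.
Variable K : comNzRingType.

Definition vamos_eval (v : 'I_8 -> K) : K :=
  \sum_(S in vamos_bases) \prod_(j in S) v j.

(** The Vamos polynomial in the sums [s] and products [p] of the pairs
    a = {1,4}, b = {2,3}, c = {5,6}, d = {7,8}.  Of the six products of two
    [p]'s only [pc * pd] survives, the other five being the circuit
    hyperplanes. *)
Definition vamos_form (sa pa sb pb sc pc sd pd : K) : K :=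
  pc * pd + pa * (sb * sc + sb * sd + sc * sd)
  + pb * (sa * sc + sa * sd + sc * sd) + pc * (sa * sb + sa * sd + sb * sd)
  + pd * (sa * sb + sa * sc + sb * sc) + sa * sb * sc * sd.

Lemma prod_vset4 (v : 'I_8 -> K) (a b c d : nat) :
  {subset [:: a; b; c; d] <= iota 1 8} -> uniq [:: a; b; c; d] ->
  \prod_(j in vset4 a b c d) v j
    = v (vlabel a) * v (vlabel b) * v (vlabel c) * v (vlabel d).
Proof.
move=> ss us; rewrite (eq_bigl _ _ (vset4E a b c d)).
rewrite -(big_uniq _ (uniq_vlabel ss us)) /= !big_cons big_nil.
by rewrite mulr1 !mulrA.
Qed.

Lemma vamos_evalE (v : 'I_8 -> K) (x := fun k => v (vlabel k)) :
  vamos_eval v = vamos_form (x 1 + x 4) (x 1 * x 4) (x 2 + x 3) (x 2 * x 3)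
    (x 5 + x 6) (x 5 * x 6) (x 7 + x 8) (x 7 * x 8).
Proof.
pose H := vamos_circuit_hyperplanes.
have sub18 (s : seq nat) : all (mem (iota 1 8)) s -> {subset s <= iota 1 8}.
  by move=> /allP.
have H4 S : S \in H -> #|S| == 4%N.
  by rewrite !inE -!orbA => /or4P[||| /orP[]] /eqP->;
    rewrite card_vset4 //; exact: sub18.
(* k is a label that belongs to exactly one of the two sets. *)
have ne k a b c d a' b' c' d' :
    all (mem (iota 1 8)) [:: k; a; b; c; d; a'; b'; c'; d'] ->
    (k \in [:: a; b; c; d]) != (k \in [:: a'; b'; c'; d']) ->
    (vset4 a b c d == vset4 a' b' c' d') = false.
  move=> /= /andP[hk /andP[ha /andP[hb /andP[hc /andP[hd h']]]]] kS.
  apply/eqP => E; move: kS; rewrite -!mem_vset4 ?E ?eqxx //; apply: sub18.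
    by rewrite /= hk h'.
  by rewrite /= hk ha hb hc hd.
have eH : \sum_(S in H) \prod_(j in S) v j
    = x 1 * x 2 * x 3 * x 4 + x 1 * x 4 * x 5 * x 6 + x 2 * x 3 * x 5 * x 6
      + x 1 * x 4 * x 7 * x 8 + x 2 * x 3 * x 7 * x 8.
  rewrite /H /vamos_circuit_hyperplanes -!setUA.
  rewrite !big_setU1 ?big_set1 ?prod_vset4 ?inE //=; try exact: sub18.
  - by rewrite !addrA.
  - by rewrite (ne 1%N).
  - by rewrite (ne 2%N) // (ne 5%N).
  - by rewrite (ne 1%N) // (ne 5%N) // (ne 1%N).
  - by rewrite (ne 2%N) // (ne 1%N) // (ne 2%N) // (ne 1%N).
have e4 := sum_card_elem_sym v 4.
rewrite (bigID (mem H)) /= in e4.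
rewrite (@eq_bigl _ _ _ _ _ _ (mem H)) in e4; last first.
  by move=> S; rewrite andb_idl //; apply: H4.
have {e4} -> : vamos_eval v = elem_sym [seq v i | i <- enum 'I_8] 4
    - \sum_(S in H) \prod_(j in S) v j.
  by rewrite -e4 addrC addrK; apply: eq_bigl => S; rewrite inE.
by rewrite eH enum_ord8 /= /vamos_form /x; ring.
Qed.
End VamosForm.

(** * The Rayleigh inequality *)

(** The Vamos polynomial with the two variables of each pair set equal. *)
Definition quartic (K : comNzRingType) (a b c d : K) : K :=
  4 * (a + b + c + d) * (b * c * d + a * c * d + a * b * d + a * b * c)
  + (c * d) ^+ 2.

Section Line.
Variable F : rcfType.
Implicit Types a b c d x y t : F.

(** The excluded points form a set of codimension two, which a line in general
    position avoids; it contains all real zeros of the Rayleigh difference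
    below. *)
Definition generic b c d : Prop :=
  [/\ ~ (b = 0 /\ c = 0), ~ (b = 0 /\ d = 0), ~ (c = 0 /\ d = 0),
      ~ (c = 0 /\ b + d = 0) & ~ (d = 0 /\ b + c = 0)].

(** Write u = bc + bd + cd, p = cd, m = c + d and k = (b+c)(b+d)(c+d), so that
    m^2 k^2 = (X^2 + Y)^2 with X = u - p and Y = m^2 u >= 4 p u.  For u > 0,
    either 4 X^2 > p^2 and (X^2 + Y)^2 >= 4 X^2 Y suffices, or u is at least
    p/2 > 0 and then Y > p^2.  For u <= 0 only equality must be excluded. *)
Lemma rayleigh_gt0 b c d : generic b c d ->
  (b * c + b * d + c * d) * (c * d) ^+ 2
    < ((b + c) * (b + d) * (c + d)) ^+ 2.
Proof.
move=> [nbc nbd ncd ncbd ndbc].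
set k := (b + c) * _ * _; set u := b * c + _ + _; set p := c * d.
have [u_le0|u_gt0] := leP u 0.
  have up_le0 : u * p ^+ 2 <= 0 by rewrite mulr_le0_ge0 ?sqr_ge0.
  rewrite lt_neqAle (le_trans up_le0) ?sqr_ge0 // andbT; apply/eqP => upk.
  have k0 : k = 0.
    by apply/eqP; rewrite -sqrf_eq0 eq_le sqr_ge0 -upk up_le0.
  have /eqP : u * p ^+ 2 = 0 by rewrite upk k0 expr0n.
  rewrite mulf_eq0 sqrf_eq0 /p mulf_eq0 => up0.
  move/eqP: k0; rewrite /k !mulf_eq0 -orbA => /or3P[] /eqP e0.
  - have cE : c = - b by lra.
    case/or3P: up0 => /eqP h.
    + have /eqP : b * b = 0 by move: h; rewrite /u cE; lra.
      by rewrite mulf_eq0 orbb => /eqP b0; case: nbc; split=> //; lra.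
    + by case: nbc; split=> //; lra.
    + by case: ndbc.
  - have dE : d = - b by lra.
    case/or3P: up0 => /eqP h.
    + have /eqP : b * b = 0 by move: h; rewrite /u dE; lra.
      by rewrite mulf_eq0 orbb => /eqP b0; case: nbd; split=> //; lra.
    + by case: ncbd.
    + by case: nbd; split=> //; lra.
  - have dE : d = - c by lra.
    case/or3P: up0 => /eqP h.
    + have /eqP : c * c = 0 by move: h; rewrite /u dE; lra.
      by rewrite mulf_eq0 orbb => /eqP c0; case: ncd; split=> //; lra.
    + by case: ncd; split=> //; lra.
    + by case: ncd; split=> //; lra.
pose m := c + d; pose X := u - p; pose Y := m ^+ 2 * u.
have m_neq0 : m != 0.
  apply: contraTneq u_gt0 => m0; rewrite -leNgt /u.
  have -> : d = - c by rewrite /m in m0; lra.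
  have := sqr_ge0 c; rewrite expr2; lra.
have m2_gt0 : 0 < m ^+ 2 by rewrite exprn_even_gt0.
have Y_gt0 : 0 < Y by rewrite mulr_gt0.
have YE : 4 * p * u <= Y.
  rewrite /Y ler_pM2r //.
  have -> : m ^+ 2 = 4 * p + (c - d) ^+ 2 by rewrite /m /p; ring.
  by rewrite lerDl sqr_ge0.
have mkE : m ^+ 2 * k ^+ 2 = (X ^+ 2 + Y) ^+ 2.
  by rewrite /Y /X /k /u /p /m; ring.
rewrite -(ltr_pM2l m2_gt0) mkE mulrA -/Y.
have [p4X|X4p] := ltP (p ^+ 2) (4 * X ^+ 2).
  apply: (@lt_le_trans _ _ (Y * (4 * X ^+ 2))); first by rewrite ltr_pM2l.
  have -> : (X ^+ 2 + Y) ^+ 2 = Y * (4 * X ^+ 2) + (X ^+ 2 - Y) ^+ 2 by ring.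
  by rewrite lerDl sqr_ge0.
have {X4p} h : (2 * u - 3 * p) * (2 * u - p) <= 0.
  have -> : (2 * u - 3 * p) * (2 * u - p) = 4 * X ^+ 2 - p ^+ 2.
    by rewrite /X; ring.
  by rewrite subr_le0.
have p_gt0 : 0 < p.
  rewrite ltNge; apply/negP => p_le0; move: h; rewrite leNgt => /negP; apply.
  by rewrite mulr_gt0 //; lra.
have p2u : p <= 2 * u.
  rewrite leNgt; apply/negP => up; move: h; rewrite leNgt => /negP; apply.
  by rewrite nmulr_rgt0; lra.
have p2Y : p ^+ 2 < Y.
  apply: lt_le_trans YE; rewrite -subr_gt0.
  have -> : 4 * p * u - p ^+ 2 = p * (4 * u - p) by ring.
  by rewrite mulr_gt0 //; lra.
apply: (@lt_le_trans _ _ (Y * Y)); first by rewrite ltr_pM2l.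
have X0 := sqr_ge0 X.
by rewrite expr2 ler_pM // ?lerDr // ltW.
Qed.

End Line.

(** * Polynomials with a prescribed coefficient of top degree *)

(** The degree of [p] is at most [n] and [c] is its coefficient of degree [n].
    As [c] may vanish, the relation is stable under sums and products without
    side conditions, unlike statements on [size] and [lead_coef]. *)
Definition lead_at (K : comNzRingType) n (p : {poly K}) (c : K) : Prop :=
  (size p <= n.+1)%N /\ p`_n = c.

Lemma lead_at_lin (K : comNzRingType) (x y : K) :
  lead_at 1 (x%:P + y *: 'X) y.
Proof.
split; last by rewrite coefD coefC coefZ coefX add0r mulr1.
rewrite (leq_trans (size_polyD _ _)) // geq_max.
rewrite (leq_trans (size_polyC_leq1 _)) //.
by rewrite (leq_trans (size_scale_leq _ _)) // size_polyX.
Qed.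

Lemma lead_atD (K : comNzRingType) n (p q : {poly K}) c d :
  lead_at n p c -> lead_at n q d -> lead_at n (p + q) (c + d).
Proof.
move=> [sp <-] [sq <-]; split; last by rewrite coefD.
by rewrite (leq_trans (size_polyD _ _)) // geq_max sp.
Qed.

Lemma lead_atM (K : comNzRingType) n m (p q : {poly K}) c d :
  lead_at n p c -> lead_at m q d -> lead_at (n + m) (p * q) (c * d).
Proof.
move=> [sp <-] [sq <-]; split.
  by apply: (leq_trans (size_polyMleq _ _)); lia.
have nlt : (n < (n + m).+1)%N by lia.
rewrite coefM (bigD1 (Ordinal nlt)) //= addKn big1 ?addr0 // => i ne.
have [ilt|ige] := ltnP i n; last first.
  rewrite nth_default ?mul0r // (leq_trans sp) // ltn_neqAle ige andbT.
  by apply: contra ne => /eqP e; apply/eqP/val_inj.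
rewrite [q`__]nth_default ?mulr0 // (leq_trans sq) //.
by have := ltn_ord i; lia.
Qed.

Lemma lead_atX (K : comNzRingType) n k (p : {poly K}) c :
  lead_at n p c -> lead_at (k * n) (p ^+ k) (c ^+ k).
Proof.
move=> pc; elim: k => [|k IHk]; last by rewrite !exprS mulSn; apply: lead_atM.
by rewrite !expr0 mul0n; split; rewrite ?size_poly1 ?coef1.
Qed.

Lemma lead_at_natM (K : comNzRingType) n k (p : {poly K}) c :
  lead_at n p c -> lead_at n (k%:R * p) (k%:R * c).
Proof.
rewrite !mulr_natl => pc; elim: k => [|k IHk].
  by rewrite !mulr0n; split; rewrite ?size_poly0 ?coef0.
by rewrite !mulrS; apply: lead_atD.
Qed.

Lemma lead_at_lead_coef (K : comNzRingType) n (p : {poly K}) c :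
  lead_at n p c -> c != 0 -> size p = n.+1 /\ lead_coef p = c.
Proof.
move=> [sp pn] c0; have sE : size p = n.+1.
  apply/eqP; rewrite eqn_leq sp ltnNge; apply: contra c0 => sn.
  by rewrite -pn nth_default.
by split=> //; rewrite lead_coefE sE.
Qed.

Lemma lead_at_pinfty (F : rcfType) n (p : {poly F}) c :
  lead_at n p c -> 0 < c -> exists T, forall t, T <= t -> 0 < p.[t].
Proof.
move=> pc c0; have [|_ lc] := lead_at_lead_coef pc; first by rewrite gt_eqF.
have [|T hT] := @poly_pinfty_gt_lc _ p; first by rewrite lc.
by exists T => t /hT; apply: lt_le_trans; rewrite lc.
Qed.

Lemma lead_at_factor (F : rcfType) (rs : seq F) (p : {poly F}) c :
  lead_at (size rs) p c -> c != 0 -> all (root p) rs -> uniq rs ->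
  p = c *: \prod_(r <- rs) ('X - r%:P).
Proof.
move=> pc c0 rp urs; have [sp lc] := lead_at_lead_coef pc c0.
by rewrite -lc; apply: all_roots_prod_XsubC; rewrite ?uniq_rootsE.
Qed.

Lemma ivt (F : rcfType) (p : {poly F}) a b :
  a < b -> p.[a] * p.[b] < 0 -> exists2 x, a < x < b & p.[x] = 0.
Proof.
move=> ab pab; have [x xab /rootP px] := poly_ivtoo (ltW ab) pab.
by exists x; rewrite // -in_itv.
Qed.

(** * Real-rootedness on generic lines *)

(** With e1, e2, e3 the elementary symmetric polynomials of b, c, d,
    [quartic a b c d = 4 (a + e1) (a e2 + e3) + (c d)^2].  Its second and first
    derivatives in [a] are [8 * quad] and [4 * cubic]. *)
Definition quad (K : comNzRingType) (b c d : K) : K := b * c + b * d + c * d.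

Definition cubic (K : comNzRingType) (a b c d : K) : K :=
  2 * (a * quad b c d) + ((b + c + d) * quad b c d + b * c * d).

Definition lin (K : comNzRingType) (x y : K) : {poly K} := x%:P + y *: 'X.

Lemma horner_lin (K : comNzRingType) (x y t : K) : (lin x y).[t] = x + y * t.
Proof. by rewrite /lin !hornerE. Qed.

Section Homogeneous.
Variables (K : comNzRingType) (a b c d : {poly K}) (ya yb yc yd : K).
Hypotheses (ha : lead_at 1 a ya) (hb : lead_at 1 b yb).
Hypotheses (hc : lead_at 1 c yc) (hd : lead_at 1 d yd).

Lemma lead_at_quad : lead_at 2 (quad b c d) (quad yb yc yd).
Proof. by rewrite /quad; do !apply: lead_atD; exact: (@lead_atM _ 1 1). Qed.

Lemma lead_at_cubic : lead_at 3 (cubic a b c d) (cubic ya yb yc yd).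
Proof.
have he := lead_at_quad.
apply: lead_atD; first by apply: lead_at_natM; exact: (@lead_atM _ 1 2).
apply: lead_atD; last first.
  by apply: (@lead_atM _ 2 1) => //; exact: (@lead_atM _ 1 1).
by apply: (@lead_atM _ 1 2) => //; do !apply: lead_atD.
Qed.

Lemma lead_at_quartic : lead_at 4 (quartic a b c d) (quartic ya yb yc yd).
Proof.
apply: lead_atD; last first.
  by apply: (@lead_atX _ 2 2); exact: (@lead_atM _ 1 1).
apply: (@lead_atM _ 1 3).
  by apply: lead_at_natM; do !apply: lead_atD.
do !apply: lead_atD; apply: (@lead_atM _ 2 1) => //;
  exact: (@lead_atM _ 1 1).
Qed.
End Homogeneous.

Section Morphism.
Variables (K L : comNzRingType) (f : {rmorphism K -> L}).

Lemma rmorph_quad b c d : f (quad b c d) = quad (f b) (f c) (f d).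
Proof. by rewrite /quad !(rmorphD, rmorphM). Qed.

Lemma rmorph_cubic a b c d :
  f (cubic a b c d) = cubic (f a) (f b) (f c) (f d).
Proof. by rewrite /cubic !(rmorphD, rmorphM, rmorph_nat, rmorph_quad). Qed.

Lemma rmorph_quartic a b c d :
  f (quartic a b c d) = quartic (f a) (f b) (f c) (f d).
Proof. by rewrite /quartic !(rmorphD, rmorphM, rmorphXn, rmorph_nat). Qed.
End Morphism.

Section Line.
Variables (F : rcfType) (xa xb xc xd ya yb yc yd : F).
Hypotheses (ya0 : 0 < ya) (yb0 : 0 < yb) (yc0 : 0 < yc) (yd0 : 0 < yd).
Hypothesis gen :
  forall t, generic (xb + yb * t) (xc + yc * t) (xd + yd * t).

Let vE t := quad (xb + yb * t) (xc + yc * t) (xd + yd * t).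
Let vG t := cubic (xa + ya * t) (xb + yb * t) (xc + yc * t) (xd + yd * t).
Let vP t := quartic (xa + ya * t) (xb + yb * t) (xc + yc * t) (xd + yd * t).
Let pE := quad (lin xb yb) (lin xc yc) (lin xd yd).
Let pG := cubic (lin xa ya) (lin xb yb) (lin xc yc) (lin xd yd).
Let pP := quartic (lin xa ya) (lin xb yb) (lin xc yc) (lin xd yd).

Let pEE t : pE.[t] = vE t.
Proof. by rewrite -horner_evalE rmorph_quad /= !horner_evalE !horner_lin. Qed.
Let pGE t : pG.[t] = vG t.
Proof. by rewrite -horner_evalE rmorph_cubic /= !horner_evalE !horner_lin. Qed.
Let pPE t : pP.[t] = vP t.
Proof.
by rewrite -horner_evalE rmorph_quartic /= !horner_evalE !horner_lin.
Qed.

Lemma quad_gt0 (b c d : F) : 0 < b -> 0 < c -> 0 < d -> 0 < quad b c d.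
Proof.
move=> *; rewrite /quad.
by do ?[apply: addr_gt0 => //|apply: mulr_gt0 => //].
Qed.

Lemma cubic_gt0 (a b c d : F) :
  0 < a -> 0 < b -> 0 < c -> 0 < d -> 0 < cubic a b c d.
Proof.
move=> *; rewrite /cubic /quad.
by do ?[apply: addr_gt0 => //|apply: mulr_gt0 => //].
Qed.

Lemma quartic_gt0 (a b c d : F) :
  0 < a -> 0 < b -> 0 < c -> 0 < d -> 0 < quartic a b c d.
Proof.
move=> *; rewrite /quartic.
by do ?[apply: addr_gt0 => //|apply: mulr_gt0 => //|apply: exprn_gt0 => //].
Qed.

(* The forms are homogeneous, so their values at x - t y are, up to sign, those
   at - x + t y; the two ends of the line are thus both ends at +oo. *)
Let far : exists T, forall t, T <= t ->
  [/\ 0 < vE t, 0 < vE (- t), 0 < vG t, vG (- t) < 0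
    & 0 < vP t /\ 0 < vP (- t)].
Proof.
have hl (x y : F) : lead_at 1 (lin x y) y := lead_at_lin x y.
have [T1 h1] := lead_at_pinfty (lead_at_quad (hl xb yb) (hl xc yc) (hl xd yd))
                  (quad_gt0 yb0 yc0 yd0).
have [T2 h2] := lead_at_pinfty
  (lead_at_quad (hl (- xb) yb) (hl (- xc) yc) (hl (- xd) yd))
                  (quad_gt0 yb0 yc0 yd0).
have [T3 h3] := lead_at_pinfty
  (lead_at_cubic (hl xa ya) (hl xb yb) (hl xc yc) (hl xd yd))
                  (cubic_gt0 ya0 yb0 yc0 yd0).
have [T4 h4] := lead_at_pinfty
  (lead_at_cubic (hl (- xa) ya) (hl (- xb) yb) (hl (- xc) yc) (hl (- xd) yd))
                  (cubic_gt0 ya0 yb0 yc0 yd0).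
have [T5 h5] := lead_at_pinfty
  (lead_at_quartic (hl xa ya) (hl xb yb) (hl xc yc) (hl xd yd))
                  (quartic_gt0 ya0 yb0 yc0 yd0).
have [T6 h6] := lead_at_pinfty
  (lead_at_quartic (hl (- xa) ya) (hl (- xb) yb) (hl (- xc) yc) (hl (- xd) yd))
                  (quartic_gt0 ya0 yb0 yc0 yd0).
pose T := Num.max (Num.max (Num.max T1 T2) (Num.max T3 T4)) (Num.max T5 T6).
exists T => t; rewrite !ge_max -!andbA =>
  /andP[/h1 + /andP[/h2 + /andP[/h3 + /andP[/h4 + /andP[/h5 + /h6]]]]].
rewrite -!horner_evalE !(rmorph_quad, rmorph_cubic, rmorph_quartic).
rewrite /= !horner_evalE !horner_lin => k1 k2 k3 k4 k5 k6.
rewrite /vE /vG /vP; split=> //.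
- by congr (0 < _) : k2; rewrite /quad; ring.
- by rewrite -oppr_gt0; congr (0 < _) : k4; rewrite /cubic /quad; ring.
- by split=> //; congr (0 < _) : k6; rewrite /quartic; ring.
Qed.

(** Completing the square in [a]; the subtracted term is, up to a constant
    factor, the discriminant of [quartic] with respect to [a]. *)
Lemma quad_mul_quartic (K : comNzRingType) (a b c d : K) :
  quad b c d * quartic a b c d = cubic a b c d ^+ 2
    - (((b + c) * (b + d) * (c + d)) ^+ 2 - quad b c d * (c * d) ^+ 2).
Proof. by rewrite /quartic /cubic /quad; ring. Qed.

(* L is the derivative of vE. *)
Let L r := yb * ((xc + yc * r) + (xd + yd * r))
  + yc * ((xb + yb * r) + (xd + yd * r))
  + yd * ((xb + yb * r) + (xc + yc * r)).

Let vE_taylor r t :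
  vE t = vE r + (t - r) * (L r + (t - r) * quad yb yc yd).
Proof. by rewrite /vE /L /quad; ring. Qed.

(* At a root of e2 the cubic equals e3, and b (c + d) = - c d, so that
   e3 (c + d) = - (c d)^2, and similarly for the other two terms of L. *)
Let L_root r : vE r = 0 -> vG r * L r < 0.
Proof.
rewrite /vE /vG /cubic => Er; rewrite Er !mulr0 !add0r /L; move: (gen r) Er.
set b := xb + _; set c := xc + _; set d := xd + _ => - [nbc nbd ncd _ _] Er.
have -> : b * c * d * (yb * (c + d) + yc * (b + d) + yd * (b + c)) =
    quad b c d * (yb * (c * d) + yc * (b * d) + yd * (b * c))
    - (yb * (c * d) ^+ 2 + yc * (b * d) ^+ 2 + yd * (b * c) ^+ 2).
  by rewrite /quad; ring.
rewrite Er mul0r add0r oppr_lt0.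
have nn (y z : F) : 0 < y -> 0 <= y * z ^+ 2.
  by move=> y0; rewrite mulr_ge0 ?sqr_ge0 // ltW.
have pp (y z z' : F) : 0 < y -> z != 0 -> z' != 0 -> 0 < y * (z * z') ^+ 2.
  by move=> y0 z0 z0'; rewrite mulr_gt0 // exprn_even_gt0 //= mulf_neq0.
have [b0|b0] := eqVneq b 0.
  have [c0|c0] := eqVneq c 0; first by case: nbc.
  have [d0|d0] := eqVneq d 0; first by case: nbd.
  by rewrite -addrA ltr_wpDr ?addr_ge0 ?nn ?pp.
have [c0|c0] := eqVneq c 0; last by rewrite ltr_wpDl ?addr_ge0 ?nn ?pp.
have [d0|d0] := eqVneq d 0; first by case: ncd.
by rewrite ltr_wpDr ?nn // ltr_wpDl ?nn ?pp.
Qed.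

(** The quadratic is negative where b + c + d = 0, hence has roots r1 < r2.
    There the cubic has the sign opposite to the slope of the quadratic, hence
    has roots p1 < r1 < p2 < r2 < p3.  At these the quartic has the sign
    opposite to that of the quadratic, that is -, +, -, which yields four
    roots. *)
Lemma quartic_line_real_rooted :
  exists2 rs : seq F, size rs = 4%N &
    pP = quartic ya yb yc yd *: \prod_(r <- rs) ('X - r%:P).
Proof.
have hl (x y : F) : lead_at 1 (lin x y) y := lead_at_lin x y.
have [T0 hT0] := far.
have q2 : 0 < quad yb yc yd by exact: quad_gt0.
(* the parameter at which b + c + d vanishes *)
pose s := - (xb + xc + xd) / (yb + yc + yd).
have vEs : vE s < 0.
  have : (xb + yb * s) + (xc + yc * s) + (xd + yd * s) = 0.
    by rewrite /s; field; rewrite gt_eqF // !addr_gt0.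
  rewrite /vE /quad; move: (gen s).
  set b := xb + _; set c := xc + _; set d := xd + _ => - [nbc _ _ _ _] bcd.
  have -> : b * c + b * d + c * d = - (b * b + c * c + b * c).
    have -> : d = - b - c by lra.
    by ring.
  have bc0 : ~~ ((b == 0) && (c == 0)).
    by apply/negP => /andP[/eqP b0 /eqP c0]; apply: nbc.
  have : 0 <= (b + c / 2) ^+ 2 by exact: sqr_ge0.
  have : 0 <= c ^+ 2 by exact: sqr_ge0.
  have [c0|c0] := eqVneq c 0.
    have : 0 < b ^+ 2.
      by rewrite exprn_even_gt0 //=; move: bc0; rewrite c0 eqxx andbT.
    by rewrite c0; nra.
  have : 0 < c ^+ 2 by rewrite exprn_even_gt0.
  by nra.
pose T := Num.max T0 (`|s| + 1).
have [|vET vENT vGT vGNT [vPT vPNT]] := hT0 T; first by rewrite le_max lexx.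
have sT : `|s| < T by rewrite lt_max ltrDl ltr01 orbT.
have [NTs {}sT] : - T < s /\ s < T by apply/andP; rewrite -ltr_norml.
have iE a b : a < b -> vE a * vE b < 0 -> exists2 x, a < x < b & vE x = 0.
  by move=> ab; rewrite -!pEE => /(ivt ab)[x]; rewrite pEE; exists x.
have iG a b : a < b -> vG a * vG b < 0 -> exists2 x, a < x < b & vG x = 0.
  by move=> ab; rewrite -!pGE => /(ivt ab)[x]; rewrite pGE; exists x.
have iP a b : a < b -> vP a * vP b < 0 -> exists2 x, a < x < b & vP x = 0.
  by move=> ab; rewrite -!pPE => /(ivt ab)[x]; rewrite pPE; exists x.
have [||r1 /andP[Tr1 r1s] Er1] := iE (- T) s; rewrite ?pmulr_rlt0 //.
have [||r2 /andP[sr2 r2T] Er2] := iE s T; rewrite ?pmulr_llt0 //.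
have L1 : L r1 < 0.
  have := vE_taylor r1 s; rewrite Er1 add0r => h; rewrite h in vEs.
  rewrite pmulr_rlt0 ?subr_gt0 // in vEs; apply: le_lt_trans vEs.
  by rewrite lerDl mulr_ge0 ?ltW ?subr_gt0.
have L2 : 0 < L r2.
  have := vE_taylor r2 s; rewrite Er2 add0r => h; rewrite h in vEs.
  rewrite nmulr_rlt0 ?subr_lt0 // in vEs; apply: lt_le_trans vEs _.
  by rewrite gerDl nmulr_rle0 ?subr_lt0 // ltW.
have G1 : 0 < vG r1 by have := L_root Er1; rewrite nmulr_llt0.
have G2 : vG r2 < 0 by have := L_root Er2; rewrite pmulr_llt0.
have r12 : r1 < r2 by apply: lt_trans sr2.
have Efact t : vE t = quad yb yc yd * ((t - r1) * (t - r2)).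
  rewrite -pEE [pE](@lead_at_factor _ [:: r1; r2] _ (quad yb yc yd)).
  - by rewrite big_cons big_seq1 !hornerE.
  - exact: (@lead_at_quad _ _ _ _ _ _ _ (hl _ _) (hl _ _) (hl _ _)).
  - by rewrite gt_eqF.
  - by rewrite /= /root !pEE Er1 Er2 eqxx.
  - by rewrite /= inE lt_eqF.
have [||p1 /andP[Tp1 p1r] Gp1] := iG (- T) r1; rewrite ?pmulr_llt0 //.
have [||p2 /andP[rp2 p2r] Gp2] := iG r1 r2; rewrite ?pmulr_rlt0 //.
have [||p3 /andP[rp3 p3T] Gp3] := iG r2 T; rewrite ?pmulr_llt0 //.
have EP t : vG t = 0 -> vE t * vP t < 0.
  move=> Gt; rewrite /vE /vP quad_mul_quartic -/(vG t) Gt expr0n sub0r.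
  by rewrite oppr_lt0 subr_gt0; apply: rayleigh_gt0.
have P1 : vP p1 < 0.
  have := EP _ Gp1; rewrite pmulr_rlt0 // Efact pmulr_rgt0 //.
  by rewrite nmulr_rgt0 ?subr_lt0 // (lt_trans p1r).
have P2 : 0 < vP p2.
  have := EP _ Gp2; rewrite nmulr_rlt0 // Efact pmulr_rlt0 //.
  by rewrite pmulr_rlt0 ?subr_gt0 ?subr_lt0.
have P3 : vP p3 < 0.
  have := EP _ Gp3; rewrite pmulr_rlt0 // Efact pmulr_rgt0 //.
  by rewrite pmulr_rgt0 ?subr_gt0 // (lt_trans r12).
have p12 : p1 < p2 by apply: lt_trans rp2.
have p23 : p2 < p3 by apply: lt_trans rp3.
have [||u1 /andP[_ u1p] Pu1] := iP (- T) p1; rewrite ?pmulr_rlt0 //.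
have [||u2 /andP[pu2 u2p] Pu2] := iP p1 p2; rewrite ?nmulr_rlt0 //.
have [||u3 /andP[pu3 u3p] Pu3] := iP p2 p3; rewrite ?pmulr_rlt0 //.
have [||u4 /andP[pu4 _] Pu4] := iP p3 T; rewrite ?nmulr_rlt0 //.
have u12 := lt_trans u1p pu2; have u23 := lt_trans u2p pu3.
have u34 := lt_trans u3p pu4.
exists [:: u1; u2; u3; u4] => //; apply: lead_at_factor.
- exact: (lead_at_quartic (hl _ _) (hl _ _) (hl _ _) (hl _ _)).
- by rewrite gt_eqF ?quartic_gt0.
- by rewrite /= /root !pPE Pu1 Pu2 Pu3 Pu4 eqxx.
rewrite /= !inE !negb_or (lt_eqF u12) (lt_eqF u23) (lt_eqF u34).
have u13 := lt_trans u12 u23; have u24 := lt_trans u23 u34.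
by rewrite (lt_eqF u13) (lt_eqF u24) (lt_eqF (lt_trans u13 u34)).
Qed.
End Line.

(** * Stability of the quartic *)

(** Each affine function with nonzero slope has at most one root. *)
Lemma exists_small_nonroot (F : realFieldType) (s : seq (F * F)) (e : F) :
  0 < e -> all (fun p => p.2 != 0) s ->
  exists2 d, 0 < d < e & all (fun p => p.1 + p.2 * d != 0) s.
Proof.
move=> e0 s0.
suff [d0 d0_gt0 hd0] : exists2 d0, 0 < d0 & forall d, 0 < d < d0 ->
    all (fun p => p.1 + p.2 * d != 0) s.
  have m0 : 0 < Num.min d0 e by rewrite lt_min d0_gt0.
  exists (Num.min d0 e / 2).
    rewrite divr_gt0 //= (@lt_le_trans _ _ (Num.min d0 e)) //.
      by rewrite ltr_pdivrMr // mulr2n mulrDr mulr1 ltrDl.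
    by rewrite ge_min lexx orbT.
  apply: hd0; rewrite divr_gt0 //= (@lt_le_trans _ _ (Num.min d0 e)) //.
    by rewrite ltr_pdivrMr // mulr2n mulrDr mulr1 ltrDl.
  by rewrite ge_min lexx.
elim: s s0 => [|[l v] s IHs] /=; first by exists 1.
move=> /andP[v0 /IHs[d0 d0_gt0 hd0]].
have [l0|l0] := eqVneq l 0.
  exists d0 => // d /[dup] dd /hd0 ->; rewrite l0 add0r mulf_neq0 //.
  by case/andP: dd => /gt_eqF ->.
exists (Num.min d0 (`|l| / `|v|)).
  by rewrite lt_min d0_gt0 divr_gt0 ?normr_gt0.
move=> d /andP[dgt0]; rewrite lt_min => /andP[dd0 dlv].
rewrite hd0 ?dgt0 // andbT addrC addr_eq0; apply/eqP => /(congr1 Num.norm).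
rewrite normrN normrM (gtr0_norm dgt0) => E.
by move: dlv; rewrite ltr_pdivlMr ?normr_gt0 // mulrC E ltxx.
Qed.

Lemma norm_horner_le_linear (C : numDomainType) (p : {poly C}) :
  p.[0] = 0 -> exists2 M : C, 0 <= M &
    forall e, 0 <= e -> e <= 1 -> `|p.[e]| <= M * e.
Proof.
move=> p0; have [q ->] : exists q, p = q * 'X.
  have /factor_theorem[q ->] : root p 0 by exact/rootP.
  by exists q; rewrite subr0.
exists (\sum_(i < size q) `|q`_i|); first exact: sumr_ge0.
move=> e e0 e1; rewrite hornerMX normrM (ger0_norm e0) ler_wpM2r //.
rewrite horner_coef (le_trans (ler_norm_sum _ _ _)) // ler_sum // => i _.
by rewrite normrM normrX (ger0_norm e0) ler_piMr // exprn_ile1.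
Qed.

Section Stable.
Variable F : rcfType.
Local Open Scope complex_scope.

Lemma norm_i_sub_real_ge1 (r : F) : 1 <= `|'i - r%:C| :> F[i].
Proof.
rewrite normc_def (_ : 1 = 1%:C) // lecR -[leLHS]sqrtr1 ler_sqrt; last first.
  by rewrite addr_ge0 ?sqr_ge0.
by simpc; rewrite /= expr1n lerDr sqr_ge0.
Qed.

(** On the line through x with direction y the quartic is [quartic y] times a
    product of factors [t - r] with r real, and [|i - r| >= 1]. *)
Lemma quartic_ge (xa xb xc xd ya yb yc yd : F) :
  0 < ya -> 0 < yb -> 0 < yc -> 0 < yd ->
  (forall t, generic (xb + yb * t) (xc + yc * t) (xd + yd * t)) ->
  (quartic ya yb yc yd)%:C
    <= `|quartic (xa +i* ya) (xb +i* yb) (xc +i* yc) (xd +i* yd)|.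
Proof.
move=> a0 b0 c0 d0 gen.
have [rs _ PE] := quartic_line_real_rooted xa a0 b0 c0 d0 gen.
have linE (x y : F) : (map_poly (real_complex F) (lin x y)).['i] = x +i* y.
  rewrite /lin rmorphD /= map_polyC /= map_polyZ /= map_polyX !hornerE.
  by simpc.
have : quartic (xa +i* ya) (xb +i* yb) (xc +i* yc) (xd +i* yd) =
    (quartic ya yb yc yd)%:C
      * (map_poly (real_complex F) (\prod_(r <- rs) ('X - r%:P))).['i].
  rewrite -hornerZ -map_polyZ -PE.
  rewrite rmorph_quartic -horner_evalE rmorph_quartic /=.
  by rewrite !horner_evalE !linE.
have q0 : 0 < quartic ya yb yc yd by apply: quartic_gt0.
move=> ->; rewrite normrM ger0_norm; last by rewrite lecR ltW.
apply: ler_peMr; first by rewrite lecR ltW.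
rewrite rmorph_prod horner_prod normr_prod.
apply: (big_ind (fun z : F[i] => 1 <= z)) => //; first exact: mulr_ege1.
by move=> r _; rewrite /= map_polyXsubC !hornerE norm_i_sub_real_ge1.
Qed.

(** Two affine functions [x + y t] and [x' + y' t] vanish at the same [t] only
    if [x y' = x' y]; the five conditions exclude this for the pairs of linear
    forms in the definition of [generic]. *)
Lemma generic_line (xb xc xd yb yc yd : F) :
  all (fun p => p != 0) [:: xb * yc - xc * yb; xb * yd - xd * yb;
    xc * yd - xd * yc; xc * (yb + yd) - (xb + xd) * yc;
    xd * (yb + yc) - (xb + xc) * yd] ->
  forall t, generic (xb + yb * t) (xc + yc * t) (xd + yd * t).
Proof.
move=> /= /and5P[/eqP h1 /eqP h2 /eqP h3 /eqP h4 /andP[/eqP h5 _]] t.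
have ind (x y x' y' : F) :
    x + y * t = 0 -> x' + y' * t = 0 -> x * y' - x' * y = 0.
  move=> /eqP; rewrite addr_eq0 => /eqP-> /eqP; rewrite addr_eq0 => /eqP->.
  by ring.
by split=> -[e e']; [apply: h1|apply: h2|apply: h3|apply: h4|apply: h5];
  apply: ind => //; rewrite -{}e'; ring.
Qed.

(** A zero [x + i y] is moved to [x + i y + e (0, 0, 1, -1)] with [e] real and
    small.  Except for finitely many [e] the perturbed line is generic, so the
    modulus is at least [quartic y]; but it is also [O(e)]. *)
Lemma quartic_stable (za zb zc zd : F[i]) :
  0 < complex.Im za -> 0 < complex.Im zb ->
  0 < complex.Im zc -> 0 < complex.Im zd -> quartic za zb zc zd != 0.
Proof.
case: za zb zc zd => [xa ya] [xb yb] [xc yc] [xd yd] /= a0 b0 c0 d0.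
apply/eqP => q0; pose q := quartic ya yb yc yd.
have q_gt0 : 0 < q by apply: quartic_gt0.
pose p : {poly F[i]} := quartic (lin (xa +i* ya) 0) (lin (xb +i* yb) 0)
  (lin (xc +i* yc) 1) (lin (xd +i* yd) (-1)).
have pE (e : F) : p.[e%:C] = quartic (xa +i* ya) (xb +i* yb)
    ((xc + e) +i* yc) ((xd - e) +i* yd).
  rewrite -horner_evalE rmorph_quartic /= !horner_evalE !horner_lin.
  by congr quartic; simpc.
have p0 : p.[0] = 0.
  by rewrite -[0]/(0%:C) pE subr0 addr0.
have [M M0 hM] := norm_horner_le_linear p0.
pose m := complex.Re M.
have ME : M = m%:C by apply/eqP; rewrite eq_complex /= eqxx (ger0_Im M0) eqxx.
have m0 : 0 <= m by rewrite -lecR -ME.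
have d_gt0 : 0 < Num.min 1 (q / (m + 1)).
  by rewrite lt_min ltr01 divr_gt0 // ltr_wpDl.
(* The five genericity conditions as affine functions of e; in the direction
   (0, 1, -1) of (b, c, d) none of the slopes vanishes. *)
have [|e /andP[e0]] := @exists_small_nonroot F [:: (xb * yc - xc * yb, - yb);
    (xb * yd - xd * yb, yb); (xc * yd - xd * yc, yd + yc);
    (xc * (yb + yd) - (xb + xd) * yc, yb + yd + yc);
    (xd * (yb + yc) - (xb + xc) * yd, - (yb + yc + yd))] _ d_gt0.
  by rewrite /= !oppr_eq0 !gt_eqF // !addr_gt0.
rewrite lt_min => /andP[e1 eqm] /= gen.
have {}gen : forall t,
    generic (xb + yb * t) ((xc + e) + yc * t) ((xd - e) + yd * t).
  apply: generic_line; move: gen => /= /and5P[g1 g2 g3 g4 /andP[g5 _]].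
  apply/and5P; split; last rewrite andbT.
  - by congr (_ != 0): g1; ring.
  - by congr (_ != 0): g2; ring.
  - by congr (_ != 0): g3; ring.
  - by congr (_ != 0): g4; ring.
  - by congr (_ != 0): g5; ring.
have := quartic_ge xa a0 b0 c0 d0 gen; rewrite -pE.
move=> /le_trans/(_ (hM e%:C _ _)); rewrite ME -rmorphM /= !lecR.
move=> /(_ (ltW e0) (ltW e1)); apply/negP; rewrite -ltNge -/q.
move: eqm; rewrite ltr_pdivlMr; last by rewrite ltr_wpDl.
apply: le_lt_trans.
by rewrite mulrDr mulr1 [m * e]mulrC lerDl ltW.
Qed.

End Stable.

(** * Merging pairs of variables *)

Section GraceWalshSzego.
Variable F : rcfType.
Local Open Scope complex_scope.

(** In complex terms: if [X Y = K^2] and both [Im X] and [Im Y] exceed [|Im K|],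
    then [Re X Re Y > (Re K)^2], and the inequality between arithmetic and
    geometric means bounds [|Im (X Y)|] from below by more than
    [2 |Re K Im K| = |Im (K^2)|]. *)
Lemma no_shifted_root (x1 x2 y1 y2 p k : F) : `|k| < x2 -> `|k| < y2 ->
  x1 * y1 - x2 * y2 = p ^+ 2 - k ^+ 2 -> x1 * y2 + x2 * y1 = 2 * p * k -> False.
Proof.
move=> kx ky h1 h2.
have k2 : k ^+ 2 < x2 * y2.
  by rewrite -real_normK ?num_real // expr2 ltr_pM.
have p2 : p ^+ 2 < x1 * y1 by lra.
have : p ^+ 2 * k ^+ 2 < (x1 * y1) * (x2 * y2) by rewrite ltr_pM ?sqr_ge0.
have : 0 <= (x1 * y2 - x2 * y1) ^+ 2 by exact: sqr_ge0.
have -> : (x1 * y2 - x2 * y1) ^+ 2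
    = (x1 * y2 + x2 * y1) ^+ 2 - 4 * ((x1 * y1) * (x2 * y2)) by ring.
rewrite h2; have -> : (2 * p * k) ^+ 2 = 4 * (p ^+ 2 * k ^+ 2) by ring.
by lra.
Qed.

(** For [a = 0] take the midpoint of [x] and [y].  Otherwise let [m + k] and
    [m - k] be the roots of [a z^2 + 2 b z + c].  The hypothesis says
    [(x - m) (y - m) = k^2]; if both roots had imaginary part at most 0, then
    [|Im k| <= - Im m], against the previous lemma. *)
Lemma grace_walsh_szego2 (a b c x y : F[i]) :
  0 < complex.Im x -> 0 < complex.Im y -> a * (x * y) + b * (x + y) + c = 0 ->
  exists2 z, 0 < complex.Im z & a * (z * z) + b * (z + z) + c = 0.
Proof.
move=> x0 y0 h; have [a0|a0] := eqVneq a 0.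
  have [z zz] : exists z, z + z = x + y by exists ((x + y) / 2); field.
  exists z; last by rewrite zz -h a0 !mul0r.
  move: x0 y0 (congr1 (@complex.Im F) zz).
  by case: x y z {h zz} => [x1 x2] [y1 y2] [z1 z2] /=; lra.
pose m := - b / a; pose k := sqrtc (m ^+ 2 - c / a).
have k2 : k ^+ 2 = m ^+ 2 - c / a by rewrite sqr_sqrtc.
have root z : (z - m) ^+ 2 = k ^+ 2 -> a * (z * z) + b * (z + z) + c = 0.
  rewrite k2 => e; have -> : a * (z * z) + b * (z + z) + c
    = a * ((z - m) ^+ 2 - (m ^+ 2 - c / a)) by rewrite /m; field.
  by rewrite e subrr mulr0.
have [k1|k1] := ltP 0 (complex.Im (m + k)).
  by exists (m + k) => //; apply: root; rewrite addrC addKr.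
have [k1'|k1'] := ltP 0 (complex.Im (m - k)).
  by exists (m - k) => //; apply: root; rewrite addrC addKr sqrrN.
have xyk : (x - m) * (y - m) = k ^+ 2.
  rewrite k2; apply: (mulfI a0).
  have -> : a * ((x - m) * (y - m)) = a * (x * y) + b * (x + y) + c
      + a * (m ^+ 2 - c / a) by rewrite /m; field.
  by rewrite h add0r.
case: (no_shifted_root (x1 := complex.Re (x - m)) (x2 := complex.Im (x - m))
  (y1 := complex.Re (y - m)) (y2 := complex.Im (y - m)) (p := complex.Re k)
  (k := complex.Im k)); move: x y m k x0 y0 k1 k1' xyk {h root k2}
   => [x1 x2] [y1 y2] [m1 m2] [p q] /= x0 y0 k1 k1'.
- by rewrite ltr_norml; lra.
- by rewrite ltr_norml; lra.
- by simpc => -[-> _]; rewrite !expr2.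
- by simpc => -[_ e]; rewrite e; ring.
Qed.

(** An expression affine in the sum and the product of two variables is
    symmetric and multiaffine in them, so the preceding lemma applies to it. *)
Lemma merge_pair (f : F[i] -> F[i] -> F[i]) (x y : F[i]) :
  (forall s p, f s p = (f 0 1 - f 0 0) * p + (f 1 0 - f 0 0) * s + f 0 0) ->
  0 < complex.Im x -> 0 < complex.Im y -> f (x + y) (x * y) = 0 ->
  exists2 z, 0 < complex.Im z & f (z + z) (z * z) = 0.
Proof.
move=> aff x0 y0; rewrite aff => /(grace_walsh_szego2 x0 y0)[z z0 zE].
by exists z; rewrite // aff.
Qed.
End GraceWalshSzego.

Section Stable.
Variable F : rcfType.
Local Open Scope complex_scope.

Lemma vamos_form_quartic (K : comNzRingType) (a b c d : K) :
  vamos_form (a + a) (a * a) (b + b) (b * b) (c + c) (c * c) (d + d) (d * d)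
  = quartic a b c d.
Proof. by rewrite /vamos_form /quartic; ring. Qed.

Lemma vamos_stable (v : 'I_8 -> F[i]) :
  (forall i, 0 < complex.Im (v i)) -> vamos_eval v != 0.
Proof.
move=> v0; apply/eqP; rewrite vamos_evalE.
set sb := v (vlabel 2) + _; set pb := v (vlabel 2) * _.
set sc := v (vlabel 5) + _; set pc := v (vlabel 5) * _.
set sd := v (vlabel 7) + _; set pd := v (vlabel 7) * _.
move=> /(merge_pair (f := fun s p => vamos_form s p sb pb sc pc sd pd)).
case=> // [s p|a a0]; first by rewrite /vamos_form; ring.
move=> /(merge_pair (f := fun s p =>
  vamos_form (a + a) (a * a) s p sc pc sd pd)).
case=> // [s p|b b0]; first by rewrite /vamos_form; ring.
move=> /(merge_pair (f := fun s p =>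
  vamos_form (a + a) (a * a) (b + b) (b * b) s p sd pd)).
case=> // [s p|c c0]; first by rewrite /vamos_form; ring.
move=> /(merge_pair (f := fun s p =>
  vamos_form (a + a) (a * a) (b + b) (b * b) (c + c) (c * c) s p)).
case=> // [s p|d d0]; first by rewrite /vamos_form; ring.
by rewrite vamos_form_quartic; apply/eqP/quartic_stable.
Qed.
End Stable.

Lemma p_vamosE (R : realType) :
  p_vamos R = \sum_(S in vamos_bases) \prod_(j in S) ('X_j + 1).
Proof.
rewrite /p_vamos /shift1 /h_vamos /bases_genpoly rmorph_sum /=.
apply: eq_bigr => S _; rewrite rmorph_prod /=; apply: eq_bigr => j _.
by rewrite comp_mpolyXU -tnth_nth tnth_mktuple.
Qed.

Lemma p_vamos_eval (R : realType) (K : comNzRingType) (f : {rmorphism R -> K})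
    (w : 'I_8 -> K) :
  (map_mpoly f (p_vamos R)).@[w] = vamos_eval (fun i => w i + 1).
Proof.
rewrite p_vamosE [map_mpoly f _]rmorph_sum rmorph_sum; apply: eq_bigr => S _ /=.
rewrite [map_mpoly f _]rmorph_prod rmorph_prod; apply: eq_bigr => j _ /=.
rewrite [map_mpoly f _]rmorphD rmorphD /=.
rewrite [map_mpoly f 1]rmorph1 rmorph1.
by rewrite [map_mpoly f _]mmapX mmap1U mevalXU.
Qed.

Lemma vamos_evalZ (K : comNzRingType) (l : K) (v : 'I_8 -> K) :
  vamos_eval (fun i => l * v i) = l ^+ 4 * vamos_eval v.
Proof. by rewrite !vamos_evalE /vamos_form; ring. Qed.

Lemma real_zero_p_vamos (R : realType) : real_zero_poly (p_vamos R).
Proof.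
move=> x mu; rewrite p_vamos_eval => h; apply/eqP; case: eqVneq => // mu0.
(* l mu is real, so l (1 + mu x) has the imaginary part of l, |Im mu| > 0. *)
pose l : R[i] := (- Num.sg (complex.Im mu))%:C%C * mu^*%C.
suff /vamos_stable : forall i, 0 < complex.Im (l * (mu * (x i)%:C%C + 1)).
  by rewrite vamos_evalZ h mulr0 eqxx.
move=> i; rewrite /l; move: mu0; case: mu {h l} => [m1 m2] /= m20.
rewrite -normr_gt0 normrEsg in m20; congr (0 < _) : m20.
by simpc; rewrite /=; ring.
Qed.

(** * The Ingleton inequality *)

Section Ingleton.
Variables (F : fieldType) (n : nat).
Implicit Types A B C D X : 'M[F]_n.

Lemma submodular_rank A B C :
  (\rank ((A :&: B) + C)%MS + \rank (A + B + C)%MS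
    <= \rank (A + C)%MS + \rank (B + C)%MS)%N.
Proof.
rewrite -[leqRHS]mxrank_sum_cap addnC leq_add //; apply: mxrankS.
  rewrite !addsmx_sub -andbA; apply/and3P; split.
  - exact: submx_trans (addsmxSl A C) (addsmxSl _ _).
  - exact: submx_trans (addsmxSl B C) (addsmxSr _ _).
  - exact: submx_trans (addsmxSr A C) (addsmxSl _ _).
by rewrite sub_capmx !addsmxS ?capmxSl ?capmxSr.
Qed.

Lemma rank_add_pair X C D :
  (\rank X + \rank (C + D)%MS <= \rank (X + C)%MS + \rank (X + D)%MS)%N.
Proof.
rewrite -[leqRHS]mxrank_sum_cap addnC leq_add //; apply: mxrankS.
  by rewrite addsmxS ?addsmxSr.
by rewrite sub_capmx !addsmxSl.
Qed.

(** With X the intersection of A and B, X + C lies in both A + C and B + C,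
    which bounds the dimension of X modulo C, and likewise modulo D.  These
    bounds and [rank_add_pair] add up to the inequality. *)
Lemma ingleton A B C D :
  (\rank A + \rank B + \rank (A + B + C)%MS + \rank (A + B + D)%MS
     + \rank (C + D)%MS
   <= \rank (A + B)%MS + \rank (A + C)%MS + \rank (A + D)%MS
     + \rank (B + C)%MS + \rank (B + D)%MS)%N.
Proof.
have := mxrank_sum_cap A B; have := submodular_rank A B C.
have := submodular_rank A B D; have := rank_add_pair (A :&: B)%MS C D.
lia.
Qed.
End Ingleton.

(** * Hermitian matrices *)

Section Hermitian.
Variable C : numClosedFieldType.
Local Notation "A ^*m" := (map_mx Num.conj (A^T)) (at level 2).

Lemma hermP n (A : 'M[C]_n) : A \is hermsymmx -> A^*m = A.
Proof. by move=> /is_hermitianmxP; rewrite expr0 scale1r => <-. Qed.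

Lemma adjM m n p (A : 'M[C]_(m, n)) (B : 'M[C]_(n, p)) :
  (A *m B)^*m = B^*m *m A^*m.
Proof. by rewrite trmx_mul map_mxM. Qed.

Lemma adjK m n (A : 'M[C]_(m, n)) : A^*m^*m = A.
Proof. by apply/matrixP => i j; rewrite !mxE conjCK. Qed.

Lemma trace_mul_adj m n (Y : 'M[C]_(m, n)) :
  \tr (Y *m Y^*m) = \sum_i \sum_j `|Y i j| ^+ 2.
Proof.
rewrite /mxtrace; apply: eq_bigr => i _; rewrite mxE.
by apply: eq_bigr => j _; rewrite !mxE normCK.
Qed.

Lemma trace_mul_adj_ge0 m n (Y : 'M[C]_(m, n)) : 0 <= \tr (Y *m Y^*m).
Proof.
by rewrite trace_mul_adj; do 2!apply: sumr_ge0 => ? _; rewrite exprn_ge0.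
Qed.

Lemma trace_mul_adj_eq0 m n (Y : 'M[C]_(m, n)) : \tr (Y *m Y^*m) = 0 -> Y = 0.
Proof.
have nn (i : 'I_m) : true -> 0 <= \sum_j `|Y i j| ^+ 2.
  by move=> _; apply: sumr_ge0 => j _; rewrite exprn_ge0.
rewrite trace_mul_adj => /eqP; rewrite psumr_eq0 // => /allP Y0.
apply/matrixP => i j; rewrite mxE.
have := Y0 i (mem_index_enum i).
rewrite /= psumr_eq0 => [/allP|k _]; last by rewrite exprn_ge0.
by move=> /(_ j (mem_index_enum j)); rewrite /= sqrf_eq0 normr_eq0 => /eqP.
Qed.

(** Equivalently, [c^-1 *: A] is an orthogonal projection for some [c > 0]. *)
Definition scaled_proj n (A : 'M[C]_n) : Prop :=
  A \is hermsymmx /\ exists2 c : C, 0 < c & A *m A = c *: A.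

Lemma scaled_proj_trace n m (A : 'M[C]_n) (W : 'M[C]_(m, n)) :
  scaled_proj A -> exists2 c : C, 0 < c &
    \tr (W *m A *m W^*m) = c * \tr (W *m A *m (W *m A)^*m).
Proof.
move=> [/hermP hA [c c0 AA]]; exists c^-1; first by rewrite invr_gt0.
rewrite adjM hA !mulmxA -[W *m A *m A]mulmxA AA -scalemxAr -scalemxAl.
by rewrite mxtraceZ mulrA mulVf ?mul1r // gt_eqF.
Qed.

(** The numbers tr (W A_i W^* ) are nonnegative and sum to 0, so each of them
    vanishes; and tr (W A_i W^* ) is a positive multiple of the squared norm of
    W A_i. *)
Lemma ker_sum_scaled_proj (I : finType) (S : {set I}) n (A : I -> 'M[C]_n) m
    (W : 'M[C]_(m, n)) :
  (forall i, scaled_proj (A i)) -> W *m (\sum_(i in S) A i) = 0 ->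
  forall i, i \in S -> W *m A i = 0.
Proof.
move=> hA W0 i iS.
have tr_ge0 j : 0 <= \tr (W *m A j *m W^*m).
  have [c c0 ->] := scaled_proj_trace W (hA j).
  by rewrite mulr_ge0 ?trace_mul_adj_ge0 // ltW.
have /eqP : \sum_(j in S) \tr (W *m A j *m W^*m) = 0.
  by rewrite -raddf_sum /= -mulmx_suml -mulmx_sumr W0 mul0mx linear0.
rewrite psumr_eq0 // => /allP/(_ i (mem_index_enum i)); rewrite iS /=.
have [c c0 ->] := scaled_proj_trace W (hA i).
by rewrite mulf_eq0 gt_eqF //= => /eqP; apply: trace_mul_adj_eq0.
Qed.

(** By duality this is [ker_sum_scaled_proj]: the sum [M] is Hermitian, so the
    adjoint of its cokernel matrix is killed by [M], hence by each summand. *)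
Lemma scaled_proj_sub_sum (I : finType) (S : {set I}) n (A : I -> 'M[C]_n) :
  (forall i, scaled_proj (A i)) -> forall i, i \in S ->
  (A i <= (\sum_(j in S) A j)%R)%MS.
Proof.
move=> hA i iS; rewrite submxE; set M := \sum_(j in S) A j.
have hM : M^*m = M.
  rewrite /M (raddf_sum (@trmx C n n)) (raddf_sum (map_mx Num.conj)) /=.
  by apply: eq_bigr => j _; apply: hermP; case: (hA j).
have /(congr1 (fun Z => Z^*m)) := mulmx_coker M.
rewrite adjM hM trmx0 map_mx0 => /(ker_sum_scaled_proj hA)/(_ _ iS).
move=> /(congr1 (fun Z => Z^*m)); rewrite adjM adjK trmx0 map_mx0 => e.
by case: (hA i) => /hermP hAi _; rewrite hAi in e; rewrite e.
Qed.

Lemma rank_diag_mx n (d : 'rV[C]_n) :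
  \rank (diag_mx d) = #|[set j | d 0 j != 0]|.
Proof.
suff -> : \rank (diag_mx d) = (\sum_j (d ord0 j != 0%R))%N.
  by rewrite -sum1dep_card -big_mkcond.
elim: n d => [|n IHn] d; first by rewrite big_ord0 thinmx0 mxrank0.
pose d' : 'rV[C]_(1 + n) := d.
have -> : \rank (diag_mx d)
    = (\rank (diag_mx (lsubmx d')) + \rank (diag_mx (rsubmx d')))%N.
  by rewrite -rank_diag_block_mx -diag_mx_row hsubmxK.
rewrite IHn big_ord_recl; congr addn; last first.
  apply: eq_bigr => j _; rewrite !mxE.
  by congr (nat_of_bool (d _ _ != _)); apply: val_inj.
rewrite [diag_mx _]mx11_scalar rank_rV !mxE eqxx mulr1n.
rewrite -scalemx1 scalemx_eq0 oner_eq0 orbF.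
by congr (nat_of_bool (~~ (d _ _ == _))); apply: val_inj.
Qed.

Lemma hermitian_diagonalize n (M : 'M[C]_n) : M \is hermsymmx ->
  exists2 P : 'M[C]_n, P \in unitmx &
    exists d : 'rV[C]_n, M = invmx P *m diag_mx d *m P.
Proof.
move=> /hermitian_normalmx/orthomx_spectralP ->.
by exists (spectralmx M); [exact: spectral_unit | exists (spectral_diag M)].
Qed.

Lemma det_one_add_diagonalizable n (P : 'M[C]_n) (d : 'rV[C]_n) (x : C) :
  P \in unitmx ->
  \det (1%:M + x *: (invmx P *m diag_mx d *m P)) = \prod_j (1 + x * d 0 j).
Proof.
move=> uP.
have -> : 1%:M + x *: (invmx P *m diag_mx d *m P)
    = invmx P *m diag_mx (\row_j (1 + x * d 0 j)) *m P.
  have -> : diag_mx (\row_j (1 + x * d 0 j)) = 1%:M + x *: diag_mx d.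
    apply/matrixP => i j; rewrite !mxE; case: eqP => _.
      by rewrite !mulr1n.
    by rewrite !mulr0n mulr0 addr0.
  by rewrite mulmxDr mulmxDl mulmx1 mulVmx // -scalemxAr -scalemxAl.
rewrite !det_mulmx det_inv mulrAC mulVr ?mul1r; last by rewrite -unitmxE.
by rewrite det_diag; apply: eq_bigr => j _; rewrite mxE.
Qed.

(** The naturals are infinitely many points in characteristic zero. *)
Lemma poly_ext (p q : {poly C}) : (forall x, p.[x] = q.[x]) -> p = q.
Proof.
move=> pq; apply/eqP; rewrite -subr_eq0; apply/negP => /negP pq0.
pose rs := [seq (i%:R : C) | i <- iota 0 (size (p - q))].
have := max_poly_roots (rs := rs) pq0; rewrite size_map size_iota ltnn => h.
suff: false by []; apply: h.
  by apply/allP => x _; rewrite /root !hornerE pq subrr.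
by rewrite map_inj_uniq ?iota_uniq //; apply: mulrIn; rewrite oner_eq0.
Qed.

Lemma size_prod_linear (I : finType) (d : I -> C) :
  size (\prod_j (1 + d j *: 'X)) = #|[set j | d j != 0]|.+1.
Proof.
have sz j : size (1 + d j *: 'X) = (d j != 0).+1.
  have [->|dj] := eqVneq (d j) 0; first by rewrite scale0r addr0 size_poly1.
  by rewrite addrC size_polyDl ?size_poly1 size_scale ?size_polyX.
rewrite size_prod; last by move=> j _; rewrite -size_poly_eq0 sz.
under eq_bigr do rewrite sz -addn1.
rewrite big_split /= sum1_card subSn ?leq_addl // addnK.
by rewrite -sum1dep_card -big_mkcond.
Qed.

(** The rank and the degree both count the nonzero eigenvalues [d], since
    det (1 + x M) is the product of the [1 + d x]. *)
Lemma rank_hermitian n (M : 'M[C]_n) (p : {poly C}) : M \is hermsymmx ->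
  (forall x, \det (1%:M + x *: M) = p.[x]) -> size p = (\rank M).+1.
Proof.
move=> /hermitian_diagonalize[P uP [d ->]] hp.
rewrite mxrankMfree ?row_free_unit //.
rewrite eqmxMfull ?row_full_unit ?unitmx_inv //.
have -> : p = \prod_j (1 + d 0 j *: 'X).
  apply: poly_ext => x; rewrite -hp det_one_add_diagonalizable // horner_prod.
  by apply: eq_bigr => j _; rewrite !hornerE mulrC.
by rewrite size_prod_linear rank_diag_mx.
Qed.

(** A nonzero eigenvalue [d] makes the determinant vanish at [x = - 1 / d],
    which forces [d = c]. *)
Lemma scaled_proj_of_det n (M : 'M[C]_n) (c : C) (N : nat) :
  M \is hermsymmx -> 0 < c ->
  (forall x, \det (1%:M + x *: M) = (1 + c * x) ^+ N) -> scaled_proj M.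
Proof.
move=> hM c0 hdet; split=> //; exists c => //.
have [P uP [d Md]] := hermitian_diagonalize hM.
have dE j : d 0 j * d 0 j = c * d 0 j.
  have [->|dj] := eqVneq (d 0 j) 0; first by rewrite !mulr0.
  congr (_ * _); have := hdet (- (d 0 j)^-1).
  rewrite Md det_one_add_diagonalizable // (bigD1 j) //= mulNr mulVf //.
  rewrite subrr mul0r.
  move=> /esym/eqP; rewrite expf_eq0 => /andP[_].
  by rewrite mulrN subr_eq0 => /eqP e; rewrite -[RHS](mulfVK dj) -e mul1r.
rewrite Md !mulmxA mulmxK // -[_ *m _ *m diag_mx d]mulmxA.
have -> : diag_mx d *m diag_mx d = c *: diag_mx d.
  rewrite mulmx_diag; apply/matrixP => i j; rewrite !mxE.
  by rewrite dE mulrnAr.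
by rewrite -scalemxAr -scalemxAl.
Qed.
End Hermitian.

(** * Ranks forced by a determinantal representation *)

(** Sets given by labels in {1, ..., 8}, so that membership of [vlabel k]
    computes for concrete lists. *)
Definition labels (s : seq nat) : {set 'I_8} := [set i : 'I_8 | i.+1 \in s].

Lemma vlabel_labels (k : nat) (s : seq nat) :
  (0 < k <= 8)%N -> (vlabel k \in labels s) = (k \in s).
Proof. by case: k => // k /andP[_ hk]; rewrite inE /= inordK. Qed.

Lemma labels_cat (s t : seq nat) : labels (s ++ t) = labels s :|: labels t.
Proof. by apply/setP => i; rewrite !inE mem_cat. Qed.

Section NoRepresentation.
Variables (C : numClosedFieldType) (n N : nat) (A : 'I_8 -> 'M[C]_n).
Hypothesis hA : forall i, A i \is hermsymmx.
Hypothesis detA : forall v : 'I_8 -> C,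
  \det (1%:M + \sum_i v i *: A i)
    = (65^-1 * vamos_eval (fun i => v i + 1)) ^+ N.

Let V (s : seq nat) : 'M[C]_n := \sum_(i in labels s) A i.

Lemma det_labels (s : seq nat) (x : C) :
  \det (1%:M + x *: V s)
    = (65^-1 * vamos_eval (fun i => (i \in labels s)%:R * x + 1)) ^+ N.
Proof.
rewrite -detA; congr (\det (_ + _)); rewrite /V scaler_sumr big_mkcond.
by apply: eq_bigr => i _; case: ifP; rewrite ?mul1r ?mul0r ?scale0r.
Qed.

(** The polynomial is affine in each variable, so on the i-th axis it is
    [65 + k x] with [k] the number of bases containing [i], namely 32 for the
    labels 1, ..., 4 and 33 for the others. *)
Lemma scaled_proj_A (i : 'I_8) : scaled_proj (A i).
Proof.
have [k k_gt0 hk] : exists2 k : C, 0 < k & forall x,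
    vamos_eval (fun j => (j \in labels [:: i.+1])%:R * x + 1) = 65 + k * x.
  have [k k_gt0 hk] : exists2 k : nat, (0 < k)%N & forall x : C,
      vamos_eval (fun j => (j \in labels [:: i.+1])%:R * x + 1) = 65 + k%:R * x.
    exists (if (i < 4)%N then 32 else 33); first by case: ifP.
    move=> x; rewrite vamos_evalE !vlabel_labels // !inE.
    case: i => [] [|[|[|[|[|[|[|[|//]]]]]]]] /= _;
      rewrite /vamos_form ?mulr1n ?mulr0n; ring.
  by exists k%:R => //; rewrite ltr0n.
apply: (@scaled_proj_of_det _ _ _ (65^-1 * k) N) => //.
  by rewrite mulr_gt0 ?invr_gt0 ?ltr0n.
move=> x; have := det_labels [:: i.+1] x; rewrite hk.
rewrite /V (big_pred1 i) => [->|j]; last by rewrite !inE eqSS.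
by congr (_ ^+ N); field.
Qed.

(** The list [P] holds the coefficients of the polynomial on the line spanned by
    the indicator of [s], expanded at the point [x = -1] where the variables
    labelled by [s] vanish. *)
Lemma rank_V (s : seq nat) (P : seq C) : last 1 P != 0 ->
  (forall x, vamos_eval (fun i => (i \in labels s)%:R * x + 1)
             = (Poly P).[x + 1]) ->
  \rank (V s) = ((size P).-1 * N)%N.
Proof.
move=> Pn0 hP.
have hV : V s \is hermsymmx.
  apply/is_hermitianmxP; rewrite expr0 scale1r /V.
  rewrite (raddf_sum (@trmx C n n)) (raddf_sum (map_mx Num.conj)) /=.
  by apply: eq_bigr => i _; rewrite hermP.
have := rank_hermitian (p := ((65^-1 *: Poly P) \Po ('X + 1%:P)) ^+ N) hV.
move=> /(_ _)/(congr1 predn) /= <-; last first.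
  by move=> x; rewrite det_labels hP horner_exp horner_comp !hornerE.
rewrite size_exp size_comp_poly2 ?size_XaddC //.
by rewrite size_scale ?invr_eq0 ?pnatr_eq0 // (PolyK Pn0).
Qed.

Lemma V_cat (s t : seq nat) : (V (s ++ t) :=: V s + V t)%MS.
Proof.
have sub (u w : seq nat) : {subset u <= w} -> (V u <= V w)%MS.
  move=> uw; rewrite /V; apply: summx_sub => i; rewrite inE => iu.
  by apply: scaled_proj_sub_sum; [exact: scaled_proj_A | rewrite inE uw].
apply/eqmxP/andP; split.
  rewrite {1}/V; apply: summx_sub => i; rewrite labels_cat inE => /orP[] it.
    apply: submx_trans (addsmxSl _ _).
    by apply: scaled_proj_sub_sum => //; exact: scaled_proj_A.
  apply: submx_trans (addsmxSr _ _).
  by apply: scaled_proj_sub_sum => //; exact: scaled_proj_A.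
by rewrite addsmx_sub !sub // => i it; rewrite mem_cat it ?orbT.
Qed.

Local Ltac vamos_expand :=
  move=> x; rewrite vamos_evalE !vlabel_labels // horner_Poly /= /vamos_form;
  ring.

(** The Ingleton inequality for the pairs a, b, c, d reads
    (2 + 2 + 4 + 4 + 4) N <= (3 + 3 + 3 + 3 + 3) N. *)
Lemma no_representation : N = 0%N.
Proof.
pose a := [:: 1; 4]%N; pose b := [:: 2; 3]%N.
pose c := [:: 5; 6]%N; pose d := [:: 7; 8]%N.
have r1 : \rank (V a) = (2 * N)%N.
  apply: (@rank_V _ [:: 13; 40; 12]); first by rewrite /= pnatr_eq0.
  by vamos_expand.
have r2 : \rank (V b) = (2 * N)%N.
  apply: (@rank_V _ [:: 13; 40; 12]); first by rewrite /= pnatr_eq0.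
  by vamos_expand.
have rab : \rank (V (a ++ b)) = (3 * N)%N.
  apply: (@rank_V _ [:: 1; 16; 32; 16]); first by rewrite /= pnatr_eq0.
  by vamos_expand.
have rac : \rank (V (a ++ c)) = (3 * N)%N.
  apply: (@rank_V _ [:: 0; 16; 33; 16]); first by rewrite /= pnatr_eq0.
  by vamos_expand.
have rad : \rank (V (a ++ d)) = (3 * N)%N.
  apply: (@rank_V _ [:: 0; 16; 33; 16]); first by rewrite /= pnatr_eq0.
  by vamos_expand.
have rbc : \rank (V (b ++ c)) = (3 * N)%N.
  apply: (@rank_V _ [:: 0; 16; 33; 16]); first by rewrite /= pnatr_eq0.
  by vamos_expand.
have rbd : \rank (V (b ++ d)) = (3 * N)%N.
  apply: (@rank_V _ [:: 0; 16; 33; 16]); first by rewrite /= pnatr_eq0.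
  by vamos_expand.
have rcd : \rank (V (c ++ d)) = (4 * N)%N.
  apply: (@rank_V _ [:: 0; 16; 32; 16; 1]); first by rewrite /= oner_eq0.
  by vamos_expand.
have rabc : \rank (V ((a ++ b) ++ c)) = (4 * N)%N.
  apply: (@rank_V _ [:: 0; 0; 13; 40; 12]); first by rewrite /= pnatr_eq0.
  by vamos_expand.
have rabd : \rank (V ((a ++ b) ++ d)) = (4 * N)%N.
  apply: (@rank_V _ [:: 0; 0; 13; 40; 12]); first by rewrite /= pnatr_eq0.
  by vamos_expand.
have := ingleton (V a) (V b) (V c) (V d).
have V3 u v w : \rank (V u + V v + V w)%MS = \rank (V ((u ++ v) ++ w)).
  by rewrite (V_cat (u ++ v) w) (adds_eqmx (V_cat u v) (eqmx_refl _)).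
by rewrite !V3 -!V_cat r1 r2 rab rac rad rbc rbd rcd rabc rabd; lia.
Qed.
End NoRepresentation.

(** * Obstruction to determinantal representations *)

Lemma meval_det_pencil (K : comNzRingType) (n m : nat) (A : 'I_n -> 'M[K]_m)
    (v : 'I_n -> K) :
  (det_pencil A).@[v] = \det (1%:M + \sum_i v i *: A i).
Proof.
rewrite /det_pencil -det_map_mx map_mxD map_mx1 map_mx_sum.
congr (\det (_ + _)); apply: eq_bigr => i _; rewrite map_mxZ /= mevalXU.
by congr (_ *: _); apply/matrixP => j k; rewrite !mxE mevalC.
Qed.

Lemma map_det_pencil (K L : comNzRingType) (f : {rmorphism K -> L}) (n m : nat)
    (A : 'I_n -> 'M[K]_m) :
  map_mpoly f (det_pencil A) = det_pencil (fun i => map_mx f (A i)).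
Proof.
rewrite /det_pencil -[LHS]det_map_mx map_mxD map_mx1 map_mx_sum.
congr (\det (_ + _)); apply: eq_bigr => i _; rewrite map_mxZ /=.
rewrite [map_mpoly f _]mmapX mmap1U.
by congr (_ *: _); apply/matrixP => j k; rewrite !mxE [map_mpoly f _]mmapC.
Qed.

Lemma det_rep_hermitian (R : realType) (n : nat) (q : {mpoly R[n]}) :
  has_det_rep q -> exists m (A : 'I_n -> 'M[R[i]]_m),
    (forall i, A i \is hermsymmx) /\
    forall v, (map_mpoly (real_complex R) q).@[v]
              = \det (1%:M + \sum_i v i *: A i).
Proof.
move=> [m _ [[A hA ->]|[A hA ->]]]; last first.
  by exists m, A; split=> // v; rewrite meval_det_pencil.
exists m, (fun i => map_mx (real_complex R) (A i)); split=> [i|v]; last first.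
  by rewrite map_det_pencil meval_det_pencil.
apply/is_hermitianmxP; rewrite expr0 scale1r; apply/matrixP => j k.
rewrite !mxE.
have /is_hermitianmxP := hA i; rewrite expr0 scale1r => /matrixP/(_ j k).
by rewrite !mxE => ->; apply/eqP; rewrite eq_complex /= oppr0 !eqxx.
Qed.

Lemma meval_p_vamos (R : realType) (w : 'I_8 -> R) :
  (p_vamos R).@[w] = vamos_eval (fun i => w i + 1).
Proof.
rewrite p_vamosE rmorph_sum; apply: eq_bigr => S _ /=.
rewrite rmorph_prod; apply: eq_bigr => j _ /=.
by rewrite rmorphD rmorph1 /= mevalXU.
Qed.

Lemma vamos_eval_one (K : comNzRingType) :
  vamos_eval (fun=> 0 + 1) = 65 :> K.
Proof. by rewrite vamos_evalE /vamos_form; ring. Qed.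

Lemma no_det_rep_power (R : realType) (N : nat) : (0 < N)%N ->
  ~ has_det_rep (p_vamos R ^+ N).
Proof.
move=> N0 /det_rep_hermitian[m [A [_ hdet]]].
have := hdet (fun=> 0); rewrite big1 => [|i _]; last exact: scale0r.
rewrite addr0 det1 [map_mpoly _ _]rmorphXn rmorphXn /= p_vamos_eval.
rewrite vamos_eval_one -natrX => /eqP; rewrite pnatr_eq1 => /eqP e.
by have := ltn_expl N (isT : (1 < 65)%N); rewrite e; case: (N) N0.
Qed.

Lemma meval_mapZ (K L : comNzRingType) (f : {rmorphism K -> L}) (n : nat)
    (c : K) (q : {mpoly K[n]}) (w : 'I_n -> L) :
  (map_mpoly f (c *: q)).@[w] = f c * (map_mpoly f q).@[w].
Proof.
rewrite -mul_mpolyC [map_mpoly _ _]rmorphM rmorphM /=.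
by rewrite [map_mpoly _ c%:MP]mmapC mevalC.
Qed.

Lemma no_det_rep_normalized_power (R : realType) (N : nat) : (0 < N)%N ->
  ~ has_det_rep (normalized (p_vamos R) ^+ N).
Proof.
move=> N0 /det_rep_hermitian[m [A [hA hdet]]]; move: N0.
suff -> : N = 0%N by [].
apply: (no_representation hA) => v; rewrite -hdet.
rewrite [map_mpoly _ _]rmorphXn rmorphXn /=; congr (_ ^+ N).
rewrite /normalized meval_p_vamos vamos_eval_one.
by rewrite meval_mapZ p_vamos_eval fmorphV rmorph_nat.
Qed.

Theorem theorem3p3 (R : realType) :
  [/\ real_zero_poly (p_vamos R),
      ~ (exists2 N : nat, (0 < N)%N & has_det_rep (p_vamos R ^+ N))
    & ~ (exists2 N : nat, (0 < N)%N & has_det_rep (normalized (p_vamos R) ^+ N))].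
Proof.
split; first exact: real_zero_p_vamos.
  by case=> N N0; exact: no_det_rep_power.
by case=> N N0; exact: no_det_rep_normalized_power.
Qed.
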